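(* Let $n\ge2$, $k=1$, and let $\mathbf J$ be a $(1,n)$-juggling pattern. Then: (1) the $\mathbf J$-admissible monomials form a free basis of the ring $\underline{Pl}_{\mathbf J}$ as a $\mathbb C[\varepsilon]$-module; (2) the ideal $\mathcal I_{\mathbf J}\subset\mathbb C[\varepsilon,\Delta^{(b)}_i]_{b\in\mathbb Z_n,\,i\in[n]}$ generated by the relations (R1)–(R5) of the context produces the reduced scheme structure of $\underline{\Pi}_{\mathbf J}$, i.e. it coincides with the defining radical ideal $\underline{\mathcal I}_{\mathbf J}$ of $\underline{\Pi}_{\mathbf J}$; and for any $\varepsilon_0\in\mathbb C$ the ideal in $\mathbb C[\Delta^{(b)}_i]_{b\in\mathbb Z_n,\,i\in[n]}$ generated by the specializations of these relations at $\varepsilon=\varepsilon_0$ gives the reduced scheme structure of the fiber $\Pi_{\mathbf J}(\varepsilon_0)$.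
   Context: Work over $\mathbb C$; $[n]=\{1,\dots,n\}$, $\mathbb Z_n=\mathbb Z/n\mathbb Z$. A $(1,n)$-juggling pattern is a sequence $\mathbf J=(J_b)_{b\in\mathbb Z_n}$ with $J_b\in[n]$ such that $J_b>1$ implies $J_{b+1}=J_b-1$. Put $L(\mathbf J)=\{b\in\mathbb Z_n:J_b=1\}$. For $b\in\mathbb Z_n$ let $W^{(b)}$ be an $n$-dimensional space with basis $w^{(b)}_1,\dots,w^{(b)}_n$; $\mathbb P(W^{(b)})$ is the space of lines in $W^{(b)}$, with homogeneous coordinates $\Delta^{(b)}_1,\dots,\Delta^{(b)}_n$ dual to this basis. Let $M_{b\to b+1}(\varepsilon)$ send $w^{(b)}_i\mapsto w^{(b+1)}_{i-1}$ for $i>1$ and $w^{(b)}_1\mapsto\varepsilon w^{(b+1)}_n$. The global positroid variety $\underline{\Pi}_{\mathbf J}\subset\mathbb A^1\times\prod_b\mathbb P(W^{(b)})$ is the set of $(\varepsilon,(U_b)_b)$ with $M_{b\to b+1}(\varepsilon)U_b\subset U_{b+1}$ and $\Delta^{(b)}_i(U_b)=0$ for $i<J_b$, for all $b\in\mathbb Z_n$; $\Pi_{\mathbf J}(\varepsilon_0)\subset\prod_b\mathbb P(W^{(b)})$ is its fiber over $\varepsilon_0$. The defining radical ideal $\underline{\mathcal I}_{\mathbf J}\subset\mathbb C[\varepsilon,\Delta^{(b)}_i]_{b\in\mathbb Z_n,\,i\in[n]}$ of $\underline{\Pi}_{\mathbf J}$ is the ideal generated by all polynomials, multi-homogeneous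 in the groups of variables $\Delta^{(b)}_\bullet$, that vanish on $\underline{\Pi}_{\mathbf J}$. The ring $\underline{Pl}_{\mathbf J}=\mathbb C[\varepsilon,\Delta^{(b)}_i]/\underline{\mathcal I}_{\mathbf J}$ is the multi-homogeneous coordinate ring of $\underline{\Pi}_{\mathbf J}$. Relations (for all $b\in\mathbb Z_n$, $1\le s\le n-1$, $i,j\in[n]$, upper indices modulo $n$; the ideal generated by relations is the ideal generated by the differences of their two sides): (R1) $\Delta^{(b)}_i=0$ for $i<J_b$; (R2) $\Delta^{(b)}_i\Delta^{(b+s)}_j=\Delta^{(b)}_{j+s}\Delta^{(b+s)}_{i-s}$ for $i-s\ge1$, $j+s\le n$; (R3) $\varepsilon\Delta^{(b)}_i\Delta^{(b+s)}_j=\Delta^{(b)}_{j+s}\Delta^{(b+s)}_{i-s+n}$ for $i-s\le0$, $j+s\le n$; (R4) $\Delta^{(b)}_i\Delta^{(b+s)}_j=\varepsilon\Delta^{(b)}_{j+s-n}\Delta^{(b+s)}_{i-s}$ for $i-s\ge1$, $j+s>n$; (R5) $\Delta^{(b)}_i\Delta^{(b+s)}_j=\Delta^{(b)}_{j+s-n}\Delta^{(b+s)}_{i-s+n}$ for $i-s\le0$, $j+s>n$. A monomial $\prod_{b\in\mathbb Z_n}\Delta^{(b)}_{i^{(b)}_1}\cdots\Delta^{(b)}_{i^{(b)}_{m_b}}$ with $i^{(b)}_1\le\dots\le i^{(b)}_{m_b}$, $m_b\ge0$, is called $\mathbf J$-admissible if (a) $b+i^{(b)}_r-1\in L(\mathbf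 J)$ (modulo $n$) for all $b\in\mathbb Z_n$, $r\in[m_b]$; (b) whenever $i^{(b)}_u>s$ for some $b\in\mathbb Z_n$, $u\in[m_b]$, $s\in[n-1]$, one has $i^{(b+s)}_r\le i^{(b)}_u-s$ for all $r\in[m_{b+s}]$ (upper index modulo $n$).
   Formalization: Literal equality of ideals in (2) fails if J≠(1,…,1) (n=2, J=(1,2): Δ^(0)_2 is missing). For the variety and all fibers, proved instead: the relation ideal's saturation is the radical ideal, and both agree in multidegrees with d_b≥1 whenever J_b>1 (all, if J=(1,…,1)). *)

(* Defs.v *)
From HB Require Import structures.
From mathcomp Require Import all_boot all_order all_algebra.
From mathcomp Require Import boolp reals complex mpoly.

Set Implicit Arguments.
Unset Strict Implicit.
Unset Printing Implicit Defensive.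

Import GRing.Theory.
Local Open Scope ring_scope.
Local Open Scope quotient_scope.

(** The base field is [R[i]] with [R : realType].  The set Z_n is ['I_n] with
    the cyclic addition [cadd].  Indices in [n] = {1, ..., n} are natural
    numbers, and [ix b i : 'I_n] is the (0-based) position of the index [i];
    the argument [b] only witnesses that ['I_n] is inhabited, and [ix b i] is
    only meaningful for [1 <= i <= n]. *)

Section Indices.
Variable n : nat.
Implicit Type b : 'I_n.

Lemma ord_gt0 b : (0 < n)%N.
Proof. exact: leq_ltn_trans (ltn_ord b). Qed.

Definition cadd b (s : nat) : 'I_n := Ordinal (ltn_pmod (b + s) (ord_gt0 b)).

Definition ix b (i : nat) : 'I_n := insubd b i.-1.

Record juggling := Juggling {
  jval :> 'I_n -> nat;
  jval_bound : forall b, (1 <= jval b <= n)%N;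
  jval_step : forall b, (1 < jval b)%N -> jval (cadd b 1) = (jval b).-1
}.

Definition Lset (J : juggling) (b : 'I_n) : Prop := J b = 1%N.

End Indices.

Section Polynomials.
Variables (n : nat) (A : comNzRingType).

(** The n * n variables are numbered by pairs (b, position) through
    [mxvec_index]. The ring C[eps, Delta] is [{mpoly {poly C}[n * n]}], that is
    C[eps][Delta], whose structure of C[eps]-module is the canonical one. *)
Definition vix (b : 'I_n) (i : nat) : 'I_(n * n) := mxvec_index b (ix b i).

Definition Delta (b : 'I_n) (i : nat) : {mpoly A[n * n]} := 'X_(vix b i).

Definition multihomog (d : 'I_n -> nat) (f : {mpoly A[n * n]}) : Prop :=
  forall m, m \in msupp f ->
  forall b : 'I_n, (\sum_(k < n) m (mxvec_index b k))%N = d b.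

Definition ideal_gen (B : comNzRingType) (S : B -> Prop) (f : B) : Prop :=
  exists (N : nat) (a g : 'I_N -> B),
    (forall t, S (g t)) /\ f = \sum_t a t * g t.

(** [relation J e f]: [f] is the difference of the two sides of one of the
    relations, with [e] substituted for eps. *)
Inductive relation (J : juggling n) (e : A) : {mpoly A[n * n]} -> Prop :=
| R1 b i of (1 <= i)%N & (i < J b)%N :
    relation J e (Delta b i)
| R2 b s i j of (1 <= s <= n.-1)%N & (1 <= i <= n)%N & (1 <= j <= n)%N
    & (s < i)%N & (j + s <= n)%N :
    relation J e (Delta b i * Delta (cadd b s) j
                  - Delta b (j + s) * Delta (cadd b s) (i - s))
| R3 b s i j of (1 <= s <= n.-1)%N & (1 <= i <= n)%N & (1 <= j <= n)%N
    & (i <= s)%N & (j + s <= n)%N :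
    relation J e (e *: (Delta b i * Delta (cadd b s) j)
                  - Delta b (j + s) * Delta (cadd b s) (i + n - s))
| R4 b s i j of (1 <= s <= n.-1)%N & (1 <= i <= n)%N & (1 <= j <= n)%N
    & (s < i)%N & (n < j + s)%N :
    relation J e (Delta b i * Delta (cadd b s) j
                  - e *: (Delta b (j + s - n) * Delta (cadd b s) (i - s)))
| R5 b s i j of (1 <= s <= n.-1)%N & (1 <= i <= n)%N & (1 <= j <= n)%N
    & (i <= s)%N & (n < j + s)%N :
    relation J e (Delta b i * Delta (cadd b s) j
                  - Delta b (j + s - n) * Delta (cadd b s) (i + n - s)).

Definition relation_ideal (J : juggling n) (e : A) : {mpoly A[n * n]} -> Prop :=
  ideal_gen (relation J e).

(** Saturation of [I] by the irrelevant ideal of the product of the n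
    projective spaces: [f] lies in it iff, on each standard chart
    [Delta^(b)_(c b) != 0 for all b], it lies in the localization of [I]. *)
Definition saturation (I : {mpoly A[n * n]} -> Prop) (f : {mpoly A[n * n]})
    : Prop :=
  forall c : 'I_n -> 'I_n, exists N : nat,
    I ((\prod_(b < n) 'X_(mxvec_index b (c b))) ^+ N * f).

(** [I] gives the reduced scheme structure on a closed subset of the product of
    projective spaces, [K] being the ideal generated by the multi-homogeneous
    polynomials that vanish on that subset.  A multi-homogeneous ideal
    determines a closed subscheme of a product of projective spaces through its
    saturation, and two ideals defining the same subscheme may still differ in
    multidegrees some components of which are zero.  The ideal of the relations
    does differ from [K] there: for n = 2 and J = (1, 2) it is generated by
    [Delta^(1)_1] and [Delta^(0)_2 * Delta^(1)_2], while [K] contains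
    [Delta^(0)_2].  The second clause says that the two ideals themselves agree
    in all the multidegrees [d] with [d b >= 1] whenever [J b > 1]; for
    J = (1, ..., 1) these are all the multidegrees. *)
Definition reduced_structure (J : juggling n) (I K : {mpoly A[n * n]} -> Prop)
    : Prop :=
  (forall f, saturation I f <-> K f) /\
  (forall d f, (forall b, (1 < J b)%N -> (0 < d b)%N) -> multihomog d f ->
     (I f <-> K f)).

End Polynomials.

Section Varieties.
Variables (R : realType) (n : nat).
Local Notation C := R[i].

(** W^(b) is ['rV[C]_n] with [w_i] the [i]-th unit row vector; maps act on row
    vectors on the right, so the row of position [k] (index [k.+1]) of [Mmx e]
    is the image of [w_(k.+1)]. *)
Definition Mmx (e : C) : 'M[C]_n :=
  \matrix_(k, l) if k == 0%N :> nat then (if l.+1 == n then e else 0)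
                 else (l.+1 == k :> nat)%:R.

(** [inPi J e U] states that [U] lies in the fiber of the global positroid
    variety over [e], that is, that [(e, U)] lies in the variety itself. *)
Definition inPi (J : juggling n) (e : C) (U : 'I_n -> {vspace 'rV[C]_n})
    : Prop :=
  [/\ forall b, \dim (U b) = 1%N,
      forall b u, u \in U b -> u *m Mmx e \in U (cadd b 1)
    & forall b u i, u \in U b -> (1 <= i < J b)%N -> u 0 (ix b i) = 0].

(** Row [b] of [u] is a vector of homogeneous coordinates of [U b]. *)
Definition hcoords (U : 'I_n -> {vspace 'rV[C]_n}) (u : 'M[C]_n) : Prop :=
  forall b, row b u \in U b /\ row b u != 0.

Definition fiber_ideal (J : juggling n) (e : C) : {mpoly C[n * n]} -> Prop :=
  ideal_gen (fun f => (exists d, multihomog d f) /\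
    forall U u, inPi J e U -> hcoords U u -> f.@[mxvec u 0] = 0).

Definition global_ideal (J : juggling n) : {mpoly {poly C}[n * n]} -> Prop :=
  ideal_gen (fun f => (exists d, multihomog d f) /\
    forall e U u, inPi J e U -> hcoords U u ->
      (map_mpoly (horner_eval e) f).@[mxvec u 0] = 0).

Definition global_pred (J : juggling n) : {pred {mpoly {poly C}[n * n]}} :=
  fun f => `[< global_ideal J f >].

End Varieties.

(** Properness of the ideal, which is required by the quotient construction:
    the lines spanned by the [w_(J b)] are a point of the variety over 0. *)
Section Proper.
Variables (R : realType) (n : nat) (J : juggling n).
Local Notation C := R[i].

Definition base_mx : 'M[C]_n := \matrix_(b, k) (k == ix b (J b))%:R.

Lemma ixE b : ix b (J b) = (J b).-1 :> nat.
Proof.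
rewrite /ix val_insubd; case/andP: (jval_bound J b) => J1 Jn.
by rewrite prednK // Jn.
Qed.

Lemma base_inPi : inPi J (0 : C) (fun b => <[row b base_mx]>%VS).
Proof.
have rowE b k : row b base_mx 0 k = (k == ix b (J b))%:R by rewrite !mxE.
have row_neq0 b : row b base_mx != 0.
  apply/eqP => /rowP/(_ (ix b (J b))) /eqP.
  by rewrite rowE mxE eqxx oner_eq0.
split=> [b|b u|b u i].
- by rewrite dim_vline row_neq0.
- case/vlineP=> a ->; rewrite -scalemxAl; apply: memvZ.
  suff [->|->] : row b base_mx *m Mmx n 0 = 0 \/
                 row b base_mx *m Mmx n 0 = row (cadd b 1) base_mx.
  + exact: mem0v.
  + exact: memv_line.
  have rME l : (row b base_mx *m Mmx n (0 : C)) 0 l = Mmx n 0 (ix b (J b)) l.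
    rewrite mxE (bigD1 (ix b (J b))) //= big1 ?addr0 => [|k kn].
      by rewrite rowE eqxx mul1r.
    by rewrite rowE (negPf kn) mul0r.
  case/andP: (jval_bound J b) => J1 _.
  have [J2|J2] := ltnP 1 (J b); last first.
    left; apply/rowP=> l; rewrite rME !mxE ixE.
    by rewrite -subn1 (eqP J2) eqxx if_same.
  right; apply/rowP=> l; rewrite rME rowE mxE ixE -val_eqE /= ixE (jval_step J2).
  by case: (J b : nat) J2 => [|[|k]].
- case/vlineP=> a -> /andP[i1 iJ]; rewrite mxE rowE -val_eqE /= ixE.
  case/andP: (jval_bound J b) => J1 Jn.
  rewrite /ix val_insubd prednK // (leq_trans (ltnW iJ) Jn).
  suff /negPf -> : i.-1 != (J b).-1 by rewrite mulr0.
  by rewrite -eqSS !prednK // ltn_eqF.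
Qed.

Lemma global_idealr_closed : idealr_closed (@global_pred R n J).
Proof.
split.
- by apply/asboolP; exists 0%N, (fun=> 0), (fun=> 0); split=> [[]//|]; rewrite big_ord0.
- apply/negP=> /asboolP [N [a [g [gS def1]]]].
  pose ev (f : {mpoly {poly C}[n * n]}) :=
    (map_mpoly (horner_eval 0) f).@[mxvec base_mx 0].
  have : ev 1 = 0.
    have evM f h : ev (f * h) = ev f * ev h by rewrite /ev rmorphM mevalM.
    have ev0 : ev 0 = 0 by rewrite /ev !raddf0.
    have evD f h : ev (f + h) = ev f + ev h by rewrite /ev !raddfD.
    apply: (etrans (congr1 ev def1)); rewrite (big_morph ev evD ev0).
    apply: big1 => t _; rewrite evM; case: (gS t) => _ /(_ _ _ _ base_inPi) ev_g.
    rewrite [ev (g t)]ev_g ?mulr0 //.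
    move=> b; split; first exact: memv_line.
    by have [/(_ b) + _ _] := base_inPi; rewrite dim_vline; case: (_ != 0).
  by rewrite /ev !rmorph1 => /eqP; rewrite oner_eq0.
- move=> p x y /asboolP [N1 [a1 [g1 [S1 ->]]]] /asboolP [N2 [a2 [g2 [S2 ->]]]].
  apply/asboolP; exists (N1 + N2)%N.
  exists (fun t => match split t with inl u => p * a1 u | inr u => a2 u end).
  exists (fun t => match split t with inl u => g1 u | inr u => g2 u end).
  split=> [t|]; first by case: (split t).
  rewrite big_split_ord /= mulr_sumr; congr (_ + _); apply: eq_bigr => t _.
    by rewrite (unsplitK (inl t)) mulrA.
  by rewrite (unsplitK (inr t)).
Qed.

HB.instance Definition _ :=
  isIdealr.Build {mpoly {poly C}[n * n]} (@global_pred R n J)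
    global_idealr_closed.

End Proper.

(** The structure of A-module on the quotient of A[X_1, ..., X_k] by an ideal. *)
Section QuotientModule.
Variables (A : comNzRingType) (k : nat) (I : idealr {mpoly A[k]}).
Local Notation Q := {ideal_quot I}.

Definition quot_scale (a : A) (x : Q) : Q := \pi_Q (a%:MP_[k]) * x.

Lemma quot_scaleA a b x : quot_scale a (quot_scale b x) = quot_scale (a * b) x.
Proof. by rewrite /quot_scale mulrA -rmorphM /= -mpolyCM. Qed.

Lemma quot_scale1 : left_id 1 quot_scale.
Proof. by move=> x; rewrite /quot_scale mpolyC1 rmorph1 mul1r. Qed.

Lemma quot_scaleDr : right_distributive quot_scale +%R.
Proof. by move=> a x y; rewrite /quot_scale mulrDr. Qed.

Lemma quot_scaleDl x : {morph quot_scale^~ x : a b / a + b}.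
Proof. by move=> a b; rewrite /quot_scale mpolyCD rmorphD mulrDl. Qed.

HB.instance Definition _ := GRing.Zmodule_isLmodule.Build A Q
  quot_scaleA quot_scale1 quot_scaleDr quot_scaleDl.

End QuotientModule.

Section CoordinateRing.
Variables (R : realType) (n : nat) (J : juggling n).

Definition Pl := {ideal_quot (@global_pred R n J)}.

HB.instance Definition _ := GRing.ComNzRing.on Pl.
HB.instance Definition _ := GRing.Lmodule.on Pl.

Definition Pl_proj (f : {mpoly {poly R[i]}[n * n]}) : Pl :=
  \pi_{ideal_quot (@global_pred R n J)} f.

End CoordinateRing.

(** The monomials in the variables Delta are the ['X_[m]] for multi-indices
    [m]; [occurs m b i] states that [Delta^(b)_i] divides ['X_[m]]. *)
Definition occurs n (m : 'X_{1..n * n}) (b : 'I_n) (i : nat) : Prop :=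
  (1 <= i <= n)%N /\ (0 < m (vix b i))%N.

Definition admissible n (J : juggling n) (m : 'X_{1..n * n}) : Prop :=
  (forall b i, occurs m b i -> Lset J (cadd b i.-1)) /\
  (forall b i s r, (1 <= s <= n.-1)%N -> occurs m b i -> (s < i)%N ->
     occurs m (cadd b s) r -> (r <= i - s)%N).

(** The family [v] restricted to the indices satisfying [P] is a basis of the
    [A]-module [V]. *)
Definition free_basis (A : nzRingType) (V : lmodType A) (T : eqType)
    (P : T -> Prop) (v : T -> V) : Prop :=
  (forall x : V, exists (s : seq T) (c : T -> A),
     {in s, forall t, P t} /\ x = \sum_(t <- s) c t *: v t) /\
  (forall (s : seq T) (c : T -> A), uniq s -> {in s, forall t, P t} ->
     \sum_(t <- s) c t *: v t = 0 -> {in s, forall t, c t = 0}).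

(* Main.v *)
Require Import Defs.
From mathcomp Require Import all_boot all_order all_algebra.
From mathcomp Require Import boolp reals complex mpoly.
From mathcomp Require Import zify ring.
Import GRing.Theory Num.Theory.
Local Open Scope ring_scope.

Set Implicit Arguments.
Unset Strict Implicit.
Unset Printing Implicit Defensive.

(** The variable [Delta^(b)_i] is best seen as an arc on the circle Z_n that
    starts at [b] and goes forward to [a = b + i - 1].  In these terms the maps
    [M] are diagonal, the relations exchange the ends of two arcs with different
    starts, up to a factor [eps], and a monomial is a configuration of arcs.  It
    is admissible when its arcs end in [L] and do not cross: an arc that passes
    over the start of another one covers all of it.

    Everything combinatorial rests on shortest arcs.  Fix the number of arcs
    that start at each point and the number that end at each point, and let
    [b], [a] be a start and an end at minimal distance.  If the arc from [b] to
    [a] does not occur in a configuration, then some arc from [b] crosses some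
    arc to [a] ([shortest_crossing]).  Hence every noncrossing configuration
    contains that arc, so it is determined by its starts and ends
    ([noncrossing_unique]); and one exchange inserts that arc into any
    configuration, so that induction rewrites any monomial with ends in [L] as a
    power of [eps] times an admissible one ([straighten]).

    For the independence of the admissible monomials, fix a value [e] of [eps]
    and a cut of the circle just after some [l] in [L].  For torus elements [t]
    and [y], the point with coordinate [t b * y a] on the arcs that do not pass
    over the cut, [e * t b * y a] on the others, and 0 on the arcs that do not
    end in [L] lies in the fiber ([torus_inPi]).  There a monomial takes the
    value of the character of its starts and ends, times a weight which is 1 if
    none of its arcs passes over the cut.  The characters of distinct admissible
    monomials are distinct, and each admissible monomial avoids some cut: the
    one after the end of its longest arc ([exists_cut]).  So a combination of
    admissible monomials that vanishes on a fiber, even over [e = 0], is zero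
    ([admissible_independent]).

    An ideal of vanishing polynomials that contains the relations therefore
    contains each vanishing polynomial that it can straighten ([vanish_mem]).
    The vanishing ideal itself contains the variables whose arc ends outside
    [L].  The ideal of the relations contains the products of such a variable
    with those that start at that end ([unsupported_mem]), which is enough in the
    multidegrees of the statement and after multiplication by the coordinates of
    a chart. *)

(** * Cyclic distances *)

Section Distance.
Variable n : nat.
Implicit Types (b p a q l : 'I_n) (s : nat).

Definition distn b a : nat := if (b <= a)%N then (a - b)%N else (a + n - b)%N.

Lemma distn_lt b a : (distn b a < n)%N.
Proof. by rewrite /distn; have := ltn_ord a; have := ltn_ord b; case: ifP; lia. Qed.

Definition dist b a : 'I_n := Ordinal (distn_lt b a).
Arguments dist : simpl never.

Lemma distE b a :
  dist b a = (if (b <= a)%N then (a - b)%N else (a + n - b)%N) :> nat.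
Proof. by []. Qed.

Lemma caddE b s : (s < n)%N ->
  cadd b s = (if (b + s < n)%N then (b + s)%N else (b + s - n)%N) :> nat.
Proof.
move=> sn /=; case: ifP => bs; first by rewrite modn_small.
rewrite -[in LHS](@subnK n (b + s)) ?modnDr ?modn_small //; have := ltn_ord b; lia.
Qed.

Lemma cadd_dist b a : cadd b (dist b a) = a.
Proof.
apply: ord_inj; rewrite caddE ?distn_lt // !distE.
have := ltn_ord a; have := ltn_ord b; do 2 case: ifP; lia.
Qed.

Lemma dist_cadd b s : (s < n)%N -> dist b (cadd b s) = s :> nat.
Proof.
move=> sn; rewrite distE caddE //; have := ltn_ord b; do 2 case: ifP; lia.
Qed.

Lemma caddA b s1 s2 : cadd (cadd b s1) s2 = cadd b (s1 + s2).
Proof. by apply/ord_inj; rewrite /= modnDml addnA. Qed.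

Lemma cadd0 b : cadd b 0 = b.
Proof. by apply/ord_inj; rewrite /= addn0 modn_small. Qed.

Lemma dist_id b : dist b b = 0%N :> nat.
Proof. by rewrite distE leqnn subnn. Qed.

Lemma dist_gt0 b p : b != p -> (0 < dist b p)%N.
Proof.
rewrite -val_eqE /= /distn => /eqP; have := ltn_ord p; have := ltn_ord b.
by case: ifP; lia.
Qed.

(** Here [p] is met on the way from [b] to [a]; in the next lemma, [b] and then
    [a] are met on the way from [p]. *)
Lemma dist_split b p a : (dist b p <= dist b a)%N ->
  dist b a = (dist b p + dist p a)%N :> nat.
Proof.
rewrite !distE; have := ltn_ord p; have := ltn_ord b; have := ltn_ord a.
by do 3 case: ifP; lia.
Qed.

Lemma dist_wrap b p a : (dist b a < dist b p)%N ->
  dist p a = (dist p b + dist b a)%N :> nat.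
Proof.
rewrite !distE; have := ltn_ord p; have := ltn_ord b; have := ltn_ord a.
by do 4 case: ifP; lia.
Qed.

Lemma dist_sym b p : b != p -> (dist b p + dist p b = n)%N.
Proof.
rewrite -val_eqE /= /distn => /eqP; have := ltn_ord p; have := ltn_ord b.
by do 2 case: ifP; lia.
Qed.

Lemma dist_add b p q :
  dist b q = (if (dist b p + dist p q < n)%N then dist b p + dist p q
              else dist b p + dist p q - n)%N :> nat.
Proof.
rewrite !distE; have := ltn_ord p; have := ltn_ord b; have := ltn_ord q.
by do !case: ifP; lia.
Qed.

End Distance.

(** * Monomials as configurations of arcs *)

Section Arcs.
Variable n : nat.
Implicit Types (b p a q l : 'I_n) (m : 'X_{1..n * n}).

(** The variable [Delta^(b)_i] with [a = b + i - 1], so that [i] is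
    [(dist b a).+1]. *)
Definition arc b a : 'I_(n * n) := mxvec_index b (dist b a).

Lemma mxvec_index_inj b k p k' :
  mxvec_index b k = mxvec_index p k' :> 'I_(n * n) -> b = p /\ k = k'.
Proof. by move=> /cast_ord_inj/enum_rank_inj [-> ->]. Qed.

Lemma arcE b (k : 'I_n) : mxvec_index b k = arc b (cadd b k).
Proof.
by rewrite /arc; congr mxvec_index; apply/ord_inj; rewrite dist_cadd.
Qed.

Lemma eq_arc b a p q : (arc b a == arc p q) = (b == p) && (a == q).
Proof.
apply/eqP/andP => [/mxvec_index_inj[bp dE]|[/eqP -> /eqP ->] //].
by rewrite -(cadd_dist b a) dE bp cadd_dist !eqxx.
Qed.

Lemma arcP (j : 'I_(n * n)) : exists b a, j = arc b a.
Proof. by case/mxvec_indexP: j => b k; exists b, (cadd b k); rewrite arcE. Qed.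

Lemma big_arc (T : Type) (idx : T) (op : Monoid.com_law idx)
    (F : 'I_(n * n) -> T) :
  \big[op/idx]_j F j = \big[op/idx]_b \big[op/idx]_a F (arc b a).
Proof.
rewrite pair_bigA; apply: reindex => /=.
have injf : injective (fun u : 'I_n * 'I_n => arc u.1 u.2).
  by case=> b a [p q] /= /eqP; rewrite eq_arc => /andP[/eqP -> /eqP ->].
apply: onW_bij; apply: inj_card_bij => //.
by rewrite card_prod !card_ord.
Qed.

Lemma ix_val b i : (0 < i <= n)%N -> ix b i = i.-1 :> nat.
Proof. by case: i => [//|i] /= i_le; rewrite /ix val_insubd /= i_le. Qed.

Lemma vixE b i : (0 < i <= n)%N -> vix b i = arc b (cadd b i.-1).
Proof. by move=> i_in; rewrite /vix arcE ix_val. Qed.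

Lemma arc_vix b a : arc b a = vix b (dist b a).+1.
Proof. by rewrite vixE /= ?cadd_dist ?distn_lt. Qed.

(** Condition (b) on admissible monomials: [p] is on the arc from [b] to [a]
    exactly when [dist b p <= dist b a]. *)
Definition noncrossing m := forall b a p q, b != p ->
  (0 < m (arc b a))%N -> (0 < m (arc p q))%N ->
  (dist b p <= dist b a)%N -> (dist p q <= dist p a)%N.

Definition supported (J : juggling n) m :=
  forall b a, (0 < m (arc b a))%N -> Lset J a.

Lemma admissibleP (J : juggling n) m :
  admissible J m <-> supported J m /\ noncrossing m.
Proof.
have occ b a : (0 < m (arc b a))%N -> occurs m b (dist b a).+1.
  by move=> mba; split; rewrite -?arc_vix // distn_lt.
split=> [[Lm nc]|[Lm nc]]; split.
- by move=> b a /occ/Lm; rewrite /= -/(dist b a : nat) cadd_dist.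
- move=> b a p q bp mba mpq bpa.
  have := nc b (dist b a).+1 (dist b p) (dist p q).+1; rewrite cadd_dist.
  move=> /(_ _ (occ _ _ mba) _ (occ _ _ mpq)).
  have := dist_gt0 bp; have := ltn_ord (dist b p); have := dist_split bpa.
  rewrite /=; lia.
- by move=> b i [i_in]; rewrite vixE // => /Lm.
- move=> b i s r s_in [i_in mi] si [r_in mr].
  rewrite vixE // in mi; rewrite vixE // in mr.
  have sn : (s < n)%N by lia.
  have bs : b != cadd b s.
    by apply/eqP => e; have := dist_cadd b sn; rewrite -e dist_id; lia.
  have := nc _ _ _ _ bs mi mr; rewrite !dist_cadd; [|lia..].
  have lt : (dist b (cadd b s) <= dist b (cadd b i.-1))%N.
    by rewrite !dist_cadd; lia.
  have := dist_split lt; rewrite !dist_cadd; lia.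
Qed.

Definition row_deg m b := (\sum_a m (arc b a))%N.
Definition col_deg m a := (\sum_b m (arc b a))%N.

Definition same_degrees m m' := row_deg m =1 row_deg m' /\ col_deg m =1 col_deg m'.

Lemma row_deg_gt0 m b : (0 < row_deg m b)%N <-> exists a, (0 < m (arc b a))%N.
Proof.
split=> [|[a mba]]; last by rewrite /row_deg (bigD1 a) //= addn_gt0 mba.
by rewrite lt0n sum_nat_eq0 negb_forall => /existsP[a /=]; rewrite -lt0n; exists a.
Qed.

Lemma col_deg_gt0 m a : (0 < col_deg m a)%N <-> exists b, (0 < m (arc b a))%N.
Proof.
split=> [|[b mba]]; last by rewrite /col_deg (bigD1 b) //= addn_gt0 mba.
by rewrite lt0n sum_nat_eq0 negb_forall => /existsP[b /=]; rewrite -lt0n; exists b.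
Qed.

Lemma row_degD m m' b : row_deg (m + m')%MM b = (row_deg m b + row_deg m' b)%N.
Proof. by rewrite -big_split; apply: eq_bigr => a _; rewrite mnmDE. Qed.

Lemma col_degD m m' a : col_deg (m + m')%MM a = (col_deg m a + col_deg m' a)%N.
Proof. by rewrite -big_split; apply: eq_bigr => b _; rewrite mnmDE. Qed.

Lemma row_deg1 b a p : row_deg U_(arc b a)%MM p = (b == p).
Proof.
rewrite /row_deg (bigD1 a) //= big1 ?addn0 => [|q qa]; rewrite mnm1E eq_arc.
  by rewrite eqxx andbT.
by rewrite eq_sym in qa; rewrite (negPf qa) andbF.
Qed.

Lemma col_deg1 b a q : col_deg U_(arc b a)%MM q = (a == q).
Proof.
rewrite /col_deg (bigD1 b) //= big1 ?addn0 => [|p pb]; rewrite mnm1E eq_arc.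
  by rewrite eqxx.
by rewrite eq_sym in pb; rewrite (negPf pb).
Qed.

Lemma mnm_gt0 m : m != 0%MM -> exists b a, (0 < m (arc b a))%N.
Proof.
rewrite -mdeg_eq0 mdegE sum_nat_eq0 negb_forall => /existsP[j] /=.
by have [b [a ->]] := arcP j; rewrite -lt0n; exists b, a.
Qed.

(** This only depends on the row and column degrees of [m]: the arc from [b] to
    [a] need not occur in [m]. *)
Definition shortest m b a := [/\ (0 < row_deg m b)%N, (0 < col_deg m a)%N &
  forall p q, (0 < row_deg m p)%N -> (0 < col_deg m q)%N ->
    (dist b a <= dist p q)%N].

Lemma exists_shortest m : m != 0%MM -> exists b a, shortest m b a.
Proof.
move=> /mnm_gt0[b0 [a0 m0]].
pose P (u : 'I_n * 'I_n) := (0 < row_deg m u.1)%N && (0 < col_deg m u.2)%N.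
have P0 : P (b0, a0).
  by apply/andP; split; [apply/row_deg_gt0; exists a0 | apply/col_deg_gt0; exists b0].
case: (arg_minnP (fun u => dist u.1 u.2 : nat) P0) => -[b a] /andP[/= db ca] min_ba.
by exists b, a; split=> // p q dp cq; apply: (min_ba (p, q)); rewrite /P /= dp.
Qed.

Lemma shortest_same m m' b a :
  same_degrees m m' -> shortest m b a -> shortest m' b a.
Proof.
by move=> [rE cE] [db ca mn]; split=> [||p q]; rewrite -?rE -?cE //; apply: mn.
Qed.

(** Otherwise [b] and [a] are joined to other points [q] and [p].  By minimality
    the arc from [b] to [q] passes over [a], and the arc from [p] to [a] passes
    over [b]. *)
Lemma shortest_crossing m b a : shortest m b a -> (0 < m (arc b a))%N \/
  exists p q, [/\ b != p, (0 < m (arc p a))%N, (0 < m (arc b q))%N,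
    (dist p b <= dist p a)%N & (dist b a < dist b q)%N].
Proof.
move=> [db ca mn]; case: (posnP (m (arc b a))) => [m0|]; last by left.
have [q mbq] := (row_deg_gt0 m b).1 db; have [p mpa] := (col_deg_gt0 m a).1 ca.
right; exists p, q.
have bp : b != p by apply: contraL mpa => /eqP <-; rewrite m0.
have aq : a != q by apply: contraL mbq => /eqP <-; rewrite m0.
have cq : (0 < col_deg m q)%N by apply/col_deg_gt0; exists b.
have dp : (0 < row_deg m p)%N by apply/row_deg_gt0; exists a.
have := mn b q db cq; have := mn p a dp ca.
have {}aq : (a != q :> nat)%N by [].
have bpn : (b != p :> nat)%N by [].
move=> pa bq; split=> //; move: pa bq bpn aq; rewrite !distE.
  have := ltn_ord p; have := ltn_ord b; have := ltn_ord a.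
  by do !case: ifP; lia.
have := ltn_ord q; have := ltn_ord b; have := ltn_ord a.
by do !case: ifP; lia.
Qed.

(** The two arcs given by [shortest_crossing] cross. *)
Lemma noncrossing_shortest m b a :
  noncrossing m -> shortest m b a -> (0 < m (arc b a))%N.
Proof.
move=> nc /shortest_crossing[//|[p [q [bp mpa mbq pba baq]]]].
by have := nc p a b q; rewrite eq_sym bp => /(_ isT mpa mbq pba); lia.
Qed.

(** By minimality no start of [m] is on the way from [b] to [a], and no arc of
    [m] that passes over [b] stops before [a]. *)
Lemma noncrossing_add m b a : noncrossing m ->
  shortest (U_(arc b a) + m)%MM b a -> noncrossing (U_(arc b a) + m)%MM.
Proof.
set m1 := (_ + m)%MM => nc [db ca mn] p q p' q' pp' mpq mpq' pp'q.
have r1 p1 q1 : (0 < m1 (arc p1 q1))%N -> (0 < row_deg m1 p1)%N.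
  by move=> h; apply/row_deg_gt0; exists q1.
have c1 p1 q1 : (0 < m1 (arc p1 q1))%N -> (0 < col_deg m1 q1)%N.
  by move=> h; apply/col_deg_gt0; exists p1.
have mE p1 q1 : (0 < m1 (arc p1 q1))%N ->
    (b == p1) && (a == q1) \/ (0 < m (arc p1 q1))%N.
  by rewrite mnmDE mnm1E eq_arc; case: andb => h; [left|right].
have pp'_gt0 := dist_gt0 pp'; have pp'qE := dist_split pp'q.
have [/andP[/eqP ? /eqP ?]|mpq1] := mE _ _ mpq.
  by subst p q; have := mn p' a (r1 _ _ mpq') ca; lia.
have [/andP[/eqP ? /eqP ?]|mpq1'] := mE _ _ mpq'.
  by subst p' q'; have := mn b q db (c1 _ _ mpq).
exact: nc mpq1 mpq1' pp'q.
Qed.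

Lemma noncrossing_le m m' : (m <= m')%MM -> noncrossing m' -> noncrossing m.
Proof.
move=> /mnm_lepP le nc b a p q bp mba mpq.
by apply: nc => //; [apply: leq_trans mba _ | apply: leq_trans mpq _].
Qed.

Lemma subU m j : (0 < m j)%N -> (U_(j) + (m - U_(j)))%MM = m.
Proof. by move=> mj; rewrite addmC submK // lep1mP -lt0n. Qed.

Lemma same_degrees_sub m m1 m1' :
  same_degrees (m + m1)%MM (m + m1')%MM -> same_degrees m1 m1'.
Proof.
move=> [rE cE]; split=> b.
  by have := rE b; rewrite !row_degD => /addnI.
by have := cE b; rewrite !col_degD => /addnI.
Qed.

(** Both configurations contain the shortest arc; remove it and repeat. *)
Lemma noncrossing_unique m m' :
  noncrossing m -> noncrossing m' -> same_degrees m m' -> m = m'.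
Proof.
have [k] := ubnP (mdeg m); elim: k m m' => // k IHk m m' /ltnSE mk ncm ncm' sd.
have [m0|nz_m] := eqVneq m 0%MM.
  rewrite m0; apply/esym/eqP; apply: contraT => /mnm_gt0[b [a mba]].
  have : (0 < row_deg m' b)%N by apply/row_deg_gt0; exists a.
  by rewrite -sd.1 m0 => /row_deg_gt0[q]; rewrite mnm0E.
have [b [a sh]] := exists_shortest nz_m.
have mba := noncrossing_shortest ncm sh.
have mba' := noncrossing_shortest ncm' (shortest_same sd sh).
rewrite -(subU mba) -(subU mba'); congr (_ + _)%MM; apply: IHk.
- by move: mk; rewrite -{1}(subU mba) mdegD mdeg1.
- apply: noncrossing_le ncm; rewrite -{2}(subU mba) addmC; exact: lem_addr.
- apply: noncrossing_le ncm'; rewrite -{2}(subU mba') addmC; exact: lem_addr.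
- by apply: (@same_degrees_sub U_(arc b a)%MM); rewrite !subU.
Qed.

(** Take for [l] the end of a longest arc.  An arc that passes over [l] and
    starts on that arc would cross it; if it starts before that arc, it would be
    longer. *)
Lemma exists_cut (J : juggling n) m b0 : noncrossing m -> supported J m ->
  exists2 l, Lset J l &
    forall b a, (0 < m (arc b a))%N -> (dist b a <= dist b l)%N.
Proof.
move=> nc Lm; have [m0|/mnm_gt0[b1 [a1 m1]]] := eqVneq m 0%MM.
  suff [l Ll] : exists l, Lset J l.
    by exists l => // b a; rewrite m0 mnm0E.
  have [k] := ubnP (J b0); elim: k b0 => // k IHk b /ltnSE Jk.
  have [J1|J1] := ltnP 1 (J b); last first.
    by exists b; apply/eqP; rewrite eqn_leq J1; case/andP: (jval_bound J b).
  apply: (IHk (cadd b 1)); rewrite jval_step //.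
  by apply: leq_trans Jk; rewrite prednK // ltnW.
have [p [l [mpl max_pl]]] : exists p l, (0 < m (arc p l))%N /\
    forall b a, (0 < m (arc b a))%N -> (dist b a <= dist p l)%N.
  pose P (u : 'I_n * 'I_n) := (0 < m (arc u.1 u.2))%N.
  case: (arg_maxnP (fun u => dist u.1 u.2 : nat) (m1 : P (b1, a1))) => -[p l] mpl mx.
  by exists p, l; split=> // b a mba; apply: (mx (b, a)).
exists l => [|b a mba]; first exact: Lm mpl.
rewrite leqNgt; apply/negP => ba_gt; have ba_le := max_pl _ _ mba.
have [pb|pb] := eqVneq p b; first by rewrite -pb in ba_gt ba_le; lia.
have [pbl|pbl] := leqP (dist p b) (dist p l).
  by have := nc _ _ _ _ pb mpl mba pbl; rewrite leqNgt ba_gt.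
by have := dist_wrap pbl; lia.
Qed.

End Arcs.

Section Degrees.
Variable n : nat.
Implicit Types (b p a q : 'I_n) (m : 'X_{1..n * n}).

Lemma row_degE m b : (\sum_(k < n) m (mxvec_index b k))%N = row_deg m b.
Proof.
rewrite (reindex (dist b)) //=; exists (cadd b) => k _; first exact: cadd_dist.
by apply: ord_inj; rewrite dist_cadd.
Qed.

Lemma same_degrees_trans m1 m2 m3 :
  same_degrees m1 m2 -> same_degrees m2 m3 -> same_degrees m1 m3.
Proof. by move=> [r1 c1] [r2 c2]; split=> b; rewrite ?r1 ?c1. Qed.

Lemma same_degreesD m m1 m2 :
  same_degrees m1 m2 -> same_degrees (m + m1)%MM (m + m2)%MM.
Proof.
by move=> [rE cE]; split=> b; rewrite ?row_degD ?col_degD ?rE ?cE.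
Qed.

Lemma mdeg_same m1 m2 : same_degrees m1 m2 -> mdeg m1 = mdeg m2.
Proof.
move=> [rE _]; rewrite !mdegE !big_arc.
by apply: eq_bigr => b _; apply: rE.
Qed.

Lemma supported_same (J : juggling n) m1 m2 :
  same_degrees m1 m2 -> supported J m1 -> supported J m2.
Proof.
move=> [_ cE] L1 b a mba; have : (0 < col_deg m1 a)%N.
  by rewrite cE; apply/col_deg_gt0; exists b.
by move=> /col_deg_gt0[p /L1].
Qed.

Lemma supportedVunsupported (J : juggling n) m :
  supported J m \/ exists b a, (0 < m (arc b a))%N /\ (1 < J a)%N.
Proof.
have [|nL] := EM (supported J m); [by left | right].
apply: contrapT => nex; apply: nL => b a mba; apply: contrapT => Ja.
apply: nex; exists b, a; split=> //; rewrite ltn_neqAle eq_sym.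
by case/andP: (jval_bound J a) => -> _; rewrite andbT; apply/eqP.
Qed.

Lemma same_degrees_exchange b a p q :
  same_degrees (U_(arc b a) + U_(arc p q))%MM (U_(arc b q) + U_(arc p a))%MM.
Proof.
split=> c; rewrite ?row_degD ?col_degD ?row_deg1 ?col_deg1 //.
by rewrite addnC.
Qed.

End Degrees.

(** * Straightening modulo an ideal *)

Section Ideals.
Variable B : comNzRingType.
Implicit Types (I S : B -> Prop) (f g : B).

Definition is_ideal I := [/\ I 0, forall f g, I f -> I g -> I (f + g)
  & forall h f, I f -> I (h * f)].

Lemma ideal_gen_ideal S : is_ideal (ideal_gen S).
Proof.
split.
- by exists 0%N, (fun=> 0), (fun=> 0); split=> [[]//|]; rewrite big_ord0.
- move=> f g [N1 [a1 [g1 [S1 ->]]]] [N2 [a2 [g2 [S2 ->]]]].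
  exists (N1 + N2)%N.
  exists (fun t => match split t with inl u => a1 u | inr u => a2 u end).
  exists (fun t => match split t with inl u => g1 u | inr u => g2 u end).
  split=> [t|]; first by case: (split t).
  rewrite big_split_ord /=; congr (_ + _); apply: eq_bigr => t _.
    by rewrite (unsplitK (inl t)).
  by rewrite (unsplitK (inr t)).
- move=> h f [N [a [g [Sg ->]]]]; exists N, (fun t => h * a t), g; split=> //.
  by rewrite mulr_sumr; apply: eq_bigr => t _; rewrite mulrA.
Qed.

Lemma ideal_gen_mem S f : S f -> ideal_gen S f.
Proof.
by move=> Sf; exists 1%N, (fun=> 1), (fun=> f); rewrite big_ord1 mul1r.
Qed.

Lemma ideal_gen_min S I : is_ideal I -> (forall f, S f -> I f) ->
  forall f, ideal_gen S f -> I f.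
Proof.
move=> [I0 ID IM] SI f [N [a [g [Sg ->]]]].
by apply: big_ind => // t _; apply/IM/SI.
Qed.

Lemma idealB I f g : is_ideal I -> I f -> I g -> I (f - g).
Proof.
by move=> [_ ID IM] If Ig; apply: ID => //; rewrite -mulN1r; apply: IM.
Qed.

End Ideals.

Section Straightening.
Variables (n : nat) (A : comNzRingType) (J : juggling n) (e : A).
Implicit Types (b p a q l : 'I_n) (m : 'X_{1..n * n}).

Lemma DeltaE b a i : i = (dist b a).+1 -> Delta A b i = 'X_[U_(arc b a)].
Proof. by move=> ->; rewrite /Delta -arc_vix. Qed.

(** As the arc from [b] to [a] passes over [p], a factor [e] can only be on the
    other side: exchanges can be applied in this direction without dividing. *)
Lemma exchange_relation b a p q : b != p -> (dist b p <= dist b a)%N ->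
  exists k, relation J e ('X_[U_(arc b a) + U_(arc p q)]
                          - e ^+ k *: 'X_[U_(arc b q) + U_(arc p a)]).
Proof.
move=> bp bpa; have bp_gt0 := dist_gt0 bp; have bpaE := dist_split bpa.
have := dist_add b p q; have bp_lt := ltn_ord (dist b p).
have ba_lt := ltn_ord (dist b a); have pq_lt := ltn_ord (dist p q).
case: ifP => sum_lt bqE.
  exists 0%N; have := @R2 n A J e b (dist b p) (dist b a).+1 (dist p q).+1.
  rewrite cadd_dist expr0 scale1r !mpolyXD.
  rewrite (@DeltaE b a) // (@DeltaE p q) // (@DeltaE b q) ?(@DeltaE p a) //.
  - by apply; lia.
  - by rewrite bpaE; lia.
  - by rewrite bqE; lia.
exists 1%N; have := @R4 n A J e b (dist b p) (dist b a).+1 (dist p q).+1.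
rewrite cadd_dist expr1 !mpolyXD.
rewrite (@DeltaE b a) // (@DeltaE p q) // (@DeltaE b q) ?(@DeltaE p a) //.
- by apply; lia.
- by rewrite bpaE; lia.
- by rewrite bqE; lia.
Qed.

Variable I : {mpoly A[n * n]} -> Prop.
Hypotheses (idI : is_ideal I) (relI : forall f, relation J e f -> I f).

Lemma exchange_mod b a p q m : b != p -> (dist b p <= dist b a)%N ->
  exists k, I ('X_[U_(arc b a) + U_(arc p q) + m]
               - e ^+ k *: 'X_[U_(arc b q) + U_(arc p a) + m]).
Proof.
move=> bp bpa; have [k /relI Ik] := exchange_relation q bp bpa; exists k.
have [_ _ IM] := idI; have := IM 'X_[m] _ Ik.
by rewrite mulrBr -scalerAr -!mpolyXD ![(m + _)%MM]addmC.
Qed.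

Lemma insert_shortest m b a : shortest m b a -> exists k m1,
  same_degrees m (U_(arc b a) + m1)%MM
  /\ I ('X_[m] - e ^+ k *: 'X_[U_(arc b a) + m1]).
Proof.
move=> /shortest_crossing[mba|[p [q [bp mpa mbq pba baq]]]].
  exists 0%N, (m - U_(arc b a))%MM; rewrite subU // expr0 scale1r subrr.
  by split=> //; case: idI.
pose m2 := (m - U_(arc p a) - U_(arc b q))%MM.
have mE : m = (U_(arc p a) + U_(arc b q) + m2)%MM.
  rewrite -addmA subU ?subU // mnmBE mnm1E eq_arc eq_sym (negPf bp) /= subn0 //.
have [k Ik] : exists k, I ('X_[U_(arc p a) + U_(arc b q) + m2]
               - e ^+ k *: 'X_[U_(arc p q) + U_(arc b a) + m2]).
  by apply: exchange_mod; rewrite // eq_sym.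
exists k, (U_(arc p q) + m2)%MM.
rewrite addmA [(U_(arc b a) + _)%MM]addmC [in 'X_[m]]mE; split=> //.
rewrite {1}mE ![(_ + m2)%MM]addmC; apply: same_degreesD.
exact: same_degrees_exchange.
Qed.

(** Insert a shortest arc by an exchange, then straighten what remains: by
    minimality that arc crosses no other. *)
Lemma straighten m : exists k m', [/\ noncrossing m', same_degrees m m'
  & I ('X_[m] - e ^+ k *: 'X_[m'])].
Proof.
have [N] := ubnP (mdeg m); elim: N m => // N IHN m /ltnSE mN.
have [->|/exists_shortest[b [a sh]]] := eqVneq m 0%MM.
  exists 0%N, 0%MM; rewrite expr0 scale1r subrr; split=> //; last by case: idI.
  by move=> b a p q _; rewrite mnm0E.
have [k [m1 [sd Ik]]] := insert_shortest sh.
have [|k' [m' [nc' sd' Ik']]] := IHN m1.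
  by move: mN; rewrite (mdeg_same sd) mdegD mdeg1.
have sd2 : same_degrees m (U_(arc b a) + m')%MM.
  exact: same_degrees_trans sd (same_degreesD _ sd').
exists (k + k')%N, (U_(arc b a) + m')%MM; split=> //.
  exact: noncrossing_add nc' (shortest_same sd2 sh).
have [_ ID IM] := idI.
have := ID _ _ Ik (IM (e ^+ k *: 'X_[U_(arc b a)]) _ Ik').
rewrite mulrBr -!scalerAl -!scalerAr -!mpolyXD scalerA -exprD.
by rewrite addrA subrK.
Qed.

Lemma normal_form f :
  (forall m, m \in msupp f -> supported J m \/ I 'X_[m]) ->
  exists g, (forall m, m \in msupp g -> admissible J m) /\ I (f - g).
Proof.
have [I0 ID IM] := idI => sf.
suff [g [adm_g Ig]] : exists g, (forall m, m \in msupp g -> admissible J m) /\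
    I (\sum_(m <- msupp f) f@_m *: 'X_[m] - g).
  by exists g; split=> //; rewrite [f in f - g]mpolyE.
elim: (msupp f) sf => [|m s IHs] sf.
  by exists 0; rewrite big_nil subr0 msupp0.
have [m' m's|g [adm_g Ig]] := IHs; first by apply: sf; rewrite inE m's orbT.
rewrite big_cons; case: (sf m (mem_head _ _)) => [Lm|Im]; last first.
  exists g; split=> //; rewrite -addrA; apply: ID => //.
  by rewrite -mul_mpolyC; apply: IM.
have [k [m' [nc' sd' Im]]] := straighten m.
exists (f@_m *: (e ^+ k *: 'X_[m']) + g); split.
  move=> x /msuppD_le; rewrite mem_cat => /orP[|/adm_g//].
  move=> /msuppZ_le/msuppZ_le; rewrite msuppX inE => /eqP ->.
  by apply/admissibleP; split=> //; apply: supported_same Lm.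
rewrite opprD addrACA -scalerBr; apply: ID => //.
by rewrite -mul_mpolyC; apply: IM.
Qed.

(** [Delta^(a)_1 = 0] when [a] is not in [L]; exchanging ends with a factor of
    row [a] turns any variable whose arc ends at [a] into that one. *)
Lemma unsupported_mem m : (forall b, (1 < J b)%N -> (0 < row_deg m b)%N) ->
  supported J m \/ I 'X_[m].
Proof.
move=> dm; have [|[b [a [mba Ja]]]] := supportedVunsupported J m; first by left.
have [I0 ID IM] := idI.
have Ia : I 'X_[U_(arc a a)].
  by rewrite -(@DeltaE a a 1) ?dist_id //; apply/relI/R1.
have Imem m' : (0 < m' (arc a a))%N -> I 'X_[m'].
  by move=> maa; rewrite -(subU maa) addmC mpolyXD; apply: IM.
right; have [ba|ba] := eqVneq b a; first by apply: Imem; rewrite ba in mba.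
have [q maq] := (row_deg_gt0 m a).1 (dm a Ja).
pose m2 := (m - U_(arc b a) - U_(arc a q))%MM.
have mE : m = (U_(arc b a) + U_(arc a q) + m2)%MM.
  by rewrite -addmA subU ?subU // mnmBE mnm1E eq_arc (negPf ba) /= subn0.
have [k Ik] := exchange_mod q m2 ba (leqnn (dist b a)).
rewrite mE -[X in I X](subrK (e ^+ k *: 'X_[U_(arc b q) + U_(arc a a) + m2])).
apply: ID => //; rewrite -mul_mpolyC; apply/IM/Imem.
by rewrite !mnmDE !mnm1E !eqxx addn1 addSn.
Qed.

End Straightening.

Section Homogeneity.
Variables (n : nat) (A : comNzRingType).
Implicit Types (b p a q : 'I_n) (f : {mpoly A[n * n]}).

Lemma multihomog_binomial m1 m2 (c1 c2 : A) : row_deg m1 =1 row_deg m2 ->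
  exists d, multihomog d (c1 *: 'X_[m1] - c2 *: 'X_[m2] : {mpoly A[n * n]}).
Proof.
move=> rE; exists (row_deg m1) => m /msuppB_le; rewrite mem_cat.
case/orP=> /msuppZ_le; rewrite msuppX inE => /eqP -> b; rewrite row_degE //.
Qed.

Lemma multihomogX m : exists d, multihomog d ('X_[m] : {mpoly A[n * n]}).
Proof.
by exists (row_deg m) => m'; rewrite msuppX inE => /eqP -> b; rewrite row_degE.
Qed.

(** The four exchange relations differ by which of [a] and [q] are met on the
    way from [b] to [p].  A product has the factor [e] when its arc from [b]
    stops before [p] and the arc from [b] in the other product does not. *)
Lemma relation_arcs (J : juggling n) (e : A) f : relation J e f ->
  (exists b a, ((dist b a).+1 < J b)%N /\ f = 'X_[U_(arc b a)]) \/
  exists b p a q, b != p /\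
   f = (if (dist b a < dist b p <= dist b q)%N then e else 1) *:
         'X_[U_(arc b a) + U_(arc p q)]
     - (if (dist b q < dist b p <= dist b a)%N then e else 1) *:
         'X_[U_(arc b q) + U_(arc p a)].
Proof.
have exch b s i j (a := cadd b i.-1) (p := cadd b s) (q := cadd p j.-1) :
    (1 <= s <= n.-1)%N -> (1 <= i <= n)%N -> (1 <= j <= n)%N ->
  [/\ b != p, dist b p = s :> nat, i = (dist b a).+1, j = (dist p q).+1
    & dist b q = (if (j + s <= n)%N then (j + s).-1 else (j + s - n).-1) :> nat
      /\ dist p a = (if (s < i)%N then (i - s).-1 else (i + n - s).-1) :> nat].
  move=> s_in i_in j_in; have bpE : dist b p = s :> nat by rewrite dist_cadd; lia.
  have baE : dist b a = i.-1 :> nat by rewrite dist_cadd; lia.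
  have pqE : dist p q = j.-1 :> nat by rewrite dist_cadd; lia.
  have bp : b != p by apply/eqP => e'; move: bpE; rewrite -e' dist_id; lia.
  split=> //; [lia|lia|split].
    by rewrite (dist_add b p q) bpE pqE; do 2 case: ifP; lia.
  case: ifP => si.
    by have := @dist_split _ b p a; rewrite bpE baE; lia.
  have := @dist_wrap _ b p a; have := dist_sym bp; rewrite bpE baE; lia.
case=> {f} [b i i1 iJ|b s i j s_in i_in j_in si js|b s i j s_in i_in j_in si js
           |b s i j s_in i_in j_in si js|b s i j s_in i_in j_in si js].
- left; have i_n : (i.-1 < n)%N by have /andP[] := jval_bound J b; lia.
  have iE : i = (dist b (cadd b i.-1)).+1 by rewrite dist_cadd; lia.
  by exists b, (cadd b i.-1); split; rewrite -?iE -?(DeltaE A iE).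
all: right; have [bp bpE iE jE [bqE paE]] := exch b s i j s_in i_in j_in.
all: set p := cadd b s in bp bpE jE bqE paE *.
all: set a := cadd b i.-1 in iE jE bqE paE; set q := cadd p j.-1 in jE bqE.
all: exists b, p, a, q; split=> //; rewrite !mpolyXD.
all: rewrite (DeltaE A iE) (DeltaE A jE) (@DeltaE _ A b q) ?(@DeltaE _ A p a).
all: do ?[by rewrite ?bqE ?paE; do ?case: ifP; lia].
all: have -> : dist b a = i.-1 :> nat by lia.
all: rewrite bqE bpE; first [rewrite js | rewrite [(j + s <= n)%N]leqNgt js /=].
all: do 2 (case: ifP => ?); rewrite ?scale1r //.
all: exfalso; lia.
Qed.

End Homogeneity.

(** * Points of the fibers *)

Section Points.
Variables (R : realType) (n : nat) (J : juggling n) (e : R[i]).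
Local Notation C := R[i].
Implicit Types (b p a q l : 'I_n) (u : 'M[C]_n).

Lemma dist_succ b a :
  dist (cadd b 1) a = (if a == b then n.-1 else (dist b a).-1) :> nat.
Proof.
have bn := ltn_ord b; have an := ltn_ord a.
have sE : cadd b 1 = (if b.+1 == n then 0 else b.+1)%N :> nat.
  rewrite /= addn1; case: eqP => [->|ne]; first by rewrite modnn.
  by rewrite modn_small; lia.
rewrite -val_eqE [X in X = _]distE sE distE /=.
by do !case: ifP; lia.
Qed.

(** The vector [w^(b)_i] is indexed by [a = b + i - 1], which [M] preserves: in
    these coordinates [M] is diagonal, with entry [e] at [b]. *)
Lemma Mmx_arc b a (k : 'I_n) : Mmx n e k (dist (cadd b 1) a) =
  if k == dist b a then (if a == b then e else 1) else 0.
Proof.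
rewrite mxE dist_succ.
have -> : (k == dist b a) = (k == dist b a :> nat) by [].
have := ltn_ord k; have := ltn_ord (dist b a).
case: (eqVneq a b) => [->|ab] dn kn.
  rewrite dist_id in dn *; rewrite prednK // eqxx.
  by case: (eqVneq (k : nat) 0%N) => // k0; rewrite gtn_eqF.
have d0 : (0 < dist b a)%N by apply: dist_gt0; rewrite eq_sym.
rewrite prednK //; case: (eqVneq (k : nat) 0%N) => [->|k0].
  by rewrite ltn_eqF // ltn_eqF.
by rewrite eq_sym; case: eqP.
Qed.

Lemma mulmx_arc (v : 'rV[C]_n) b a :
  (v *m Mmx n e) 0 (dist (cadd b 1) a) =
  (if a == b then e else 1) * v 0 (dist b a).
Proof.
rewrite mxE (bigD1 (dist b a)) //= big1 => [|k /negPf kn].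
  by rewrite addr0 Mmx_arc eqxx mulrC.
by rewrite Mmx_arc kn mulr0.
Qed.

Section Relations.
Variables (U : 'I_n -> {vspace 'rV[C]_n}) (u : 'M[C]_n).
Hypotheses (piU : inPi J e U) (uU : hcoords U u).

Lemma inPi_step b : exists c, forall a,
  (if a == b then e else 1) * u b (dist b a) =
  c * u (cadd b 1) (dist (cadd b 1) a).
Proof.
have [dimU MU _] := piU; have [ub _] := uU b; have [ub1 nz_ub1] := uU (cadd b 1).
have /eqP UE : <[row (cadd b 1) u]>%VS == U (cadd b 1).
  by rewrite eqEdim -memvE ub1 dimU dim_vline nz_ub1.
have := MU b _ ub; rewrite -UE => /vlineP[c cE]; exists c => a.
by have := congr1 (fun v : 'rV_n => v 0 (dist (cadd b 1) a)) cE;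
  rewrite mulmx_arc !mxE.
Qed.

Lemma inPi_chain b p : exists c, forall a,
  (if (dist b a < dist b p)%N then e else 1) * u b (dist b a) =
  c * u p (dist p a).
Proof.
suff chain s : (s < n)%N -> exists c, forall a,
  (if (dist b a < s)%N then e else 1) * u b (dist b a) =
  c * u (cadd b s) (dist (cadd b s) a).
  by have := chain _ (ltn_ord (dist b p)); rewrite cadd_dist.
elim: s => [_|s IHs sn]; first by exists 1 => a; rewrite cadd0.
have [c cE] := IHs (ltnW sn); have [c' cE'] := inPi_step (cadd b s).
exists (c * c') => a; rewrite -(addn1 s) -caddA -mulrA -cE' mulrCA -cE mulrA.
congr (_ * _); rewrite addn1 ltnS.
have -> : (a == cadd b s) = (dist b a == s :> nat).
  apply/eqP/eqP => [->|<-]; first by rewrite dist_cadd // ltnW.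
  by rewrite cadd_dist.
by case: ltngtP => _; rewrite ?mul1r ?mulr1.
Qed.

Lemma meval_arc b a : ('X_[U_(arc b a)]).@[mxvec u 0] = u b (dist b a).
Proof. by rewrite mevalXU /arc mxvecE. Qed.

(** An arc ending at a point [a] outside [L] continues to [a] itself, where the
    coordinate vanishes. *)
Lemma unsupported_eq0 b a : (1 < J a)%N -> u b (dist b a) = 0.
Proof.
move=> Ja; have [c /(_ a)] := inPi_chain b a; rewrite ltnn mul1r => ->.
have [_ _ z] := piU; have [ua _] := uU a; have := z a _ 1%N ua Ja.
rewrite mxE; suff -> : dist a a = ix a 1 by move=> ->; rewrite mulr0.
apply: ord_inj; rewrite dist_id ix_val //=.
exact: leq_ltn_trans (ltn_ord a).
Qed.

(** The vector of [b] is mapped by [M] to a multiple of the vector of [p], and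
    the two products of a relation become the same product of coordinates at
    [p]. *)
Lemma relation_vanish f : relation J e f -> f.@[mxvec u 0] = 0.
Proof.
case/relation_arcs=> [[b [a [iJ ->]]]|[b [p [a [q [bp ->]]]]]].
  rewrite meval_arc; have [_ _ z] := piU; have [ub _] := uU b.
  have := z b _ (dist b a).+1 ub iJ; rewrite mxE => <-; congr (u b _).
  by apply: ord_inj; rewrite ix_val ?(ltn_ord (dist b a)).
rewrite mevalB !mevalZ !mpolyXD !mevalM !meval_arc.
have [c cE] := inPi_chain b p; have := cE q; have := cE a => {cE}.
have [ap|pa] := ltnP (dist b a) (dist b p);
  have [qp|pq] := ltnP (dist b q) (dist b p) => /= aE qE.
- (* Both [a] and [q] are met before [p], so that only [e] times the identity is
     obtained in this direction; on the way from [p] to [b] neither is met. *)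
  have [c' cE] := inPi_chain p b; have := cE q; have := cE a.
  rewrite (dist_wrap ap) (dist_wrap qp) !ltnNge !leq_addr /= !mul1r => -> ->.
  by ring.
- by rewrite mulrA aE mul1r; move: qE; rewrite mul1r => ->; ring.
- by move: aE; rewrite mul1r [e * _]mulrA qE !mul1r => ->; ring.
- by move: aE qE; rewrite !mul1r => -> ->; ring.
Qed.

End Relations.

Section Torus.
Variables (l : 'I_n) (t y : 'I_n -> C).
Hypotheses (Ll : Lset J l) (t0 : forall b, t b != 0) (y0 : forall a, y a != 0).

Definition weight b a : C :=
  if J a == 1%N then (if (dist b a <= dist b l)%N then 1 else e) else 0.

(** A point of the fiber that is the image of a torus element.  Over [e = 0] its
    nonzero coordinates are those of the arcs that end in [L] and do not pass
    over the cut between [l] and its successor. *)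
Definition torus_mx : 'M[C]_n :=
  \matrix_(b, k) (t b * y (cadd b k) * weight b (cadd b k)).

Lemma torus_mxE b a : torus_mx b (dist b a) = t b * y a * weight b a.
Proof. by rewrite mxE cadd_dist. Qed.

Lemma torus_row_neq0 b : row b torus_mx != 0.
Proof.
apply/eqP => /rowP/(_ (dist b l))/eqP; rewrite mxE torus_mxE mxE /weight.
by rewrite Ll eqxx leqnn mulr1 mulf_eq0 (negPf (t0 b)) (negPf (y0 l)).
Qed.

Lemma jval_shift b s : (s < J b)%N -> J (cadd b s) = (J b - s)%N.
Proof.
elim: s => [|s IHs] sJ; first by rewrite cadd0 subn0.
have {}IHs := IHs (ltnW sJ).
by rewrite -(addn1 s) -caddA jval_step IHs ?subnDA ?subn1 // ltn_subRL addn1.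
Qed.

Lemma weight_step b a : (if a == b then e else 1) * weight b a =
  (if b == l then e else 1) * weight (cadd b 1) a.
Proof.
rewrite /weight; case: (J a == 1%N); last by rewrite !mulr0.
have bl0 : b != l -> (0 < dist b l)%N by apply: dist_gt0.
have ba0 : a != b -> (0 < dist b a)%N by rewrite eq_sym; apply: dist_gt0.
have := ltn_ord (dist b a); have := ltn_ord (dist b l); rewrite !dist_succ.
rewrite [l == b]eq_sym; case: (eqVneq b l) bl0 => [bl _|bl /(_ isT) bl0].
  case: (eqVneq a b) ba0 => [-> _|ab /(_ isT) ba0]; rewrite -bl dist_id => n0 an.
    by rewrite !leqnn.
  rewrite leqNgt ba0 /=; have -> : ((dist b a).-1 <= n.-1)%N by lia.
  by rewrite mulr1 mul1r.
case: (eqVneq a b) ba0 => [-> _|ab /(_ isT) ba0] ln an.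
  rewrite dist_id leq0n; have -> : (n.-1 <= (dist b l).-1)%N = false by lia.
  by rewrite mulr1 mul1r.
by have -> : ((dist b a).-1 <= (dist b l).-1)%N = (dist b a <= dist b l)%N by lia.
Qed.

Lemma torus_inPi : inPi J e (fun b => <[row b torus_mx]>%VS).
Proof.
split=> [b|b v|b v i].
- by rewrite dim_vline torus_row_neq0.
- case/vlineP=> c ->; rewrite -scalemxAl; apply: memvZ.
  apply/vlineP; exists ((if b == l then e else 1) * (t b / t (cadd b 1))).
  apply/rowP => k; have -> : k = dist (cadd b 1) (cadd (cadd b 1) k).
    by apply: ord_inj; rewrite dist_cadd.
  rewrite mulmx_arc !mxE !cadd_dist; move: (cadd _ k) => a.
  have := weight_step b a; have := t0 (cadd b 1).
  move: (weight b a) (weight _ a) (t _) (if a == b then _ else _).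
  move=> w w' t' x t'0 wE; rewrite mulrCA wE; move: (if b == l then _ else _) => z.
  by field.
- case/vlineP=> c -> /andP[i1 iJ]; rewrite mxE.
  have i_n : (0 < i <= n)%N by have /andP[] := jval_bound J b; lia.
  rewrite [in X in _ * X]mxE mxE ix_val // /weight jval_shift; last by lia.
  have -> : (J b - i.-1)%N == 1%N = false by lia.
  by rewrite !mulr0.
Qed.

Lemma torus_hcoords : hcoords (fun b => <[row b torus_mx]>%VS) torus_mx.
Proof. by move=> b; split; [apply: memv_line | apply: torus_row_neq0]. Qed.

End Torus.

End Points.

(** * Linear independence of the admissible monomials *)

(** If [chi x h] and [chi y h] differ, then the relation at [mulG g h] minus
    [chi x h] times the relation at [g] no longer involves [chi x], and its
    coefficient at [chi y] is a nonzero multiple of [c y]. *)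
Lemma characters_free (F : idomainType) (G : Type) (mulG : G -> G -> G)
    (T : eqType) (chi : T -> G -> F) (s : seq T) (c : T -> F) :
  (forall x g h, chi x (mulG g h) = chi x g * chi x h) ->
  (forall x, exists g, chi x g != 0) ->
  {in s &, forall x y, x != y -> exists g, chi x g != chi y g} ->
  uniq s -> (forall g, \sum_(x <- s) c x * chi x g = 0) ->
  {in s, forall x, c x = 0}.
Proof.
move=> chiM chi0; elim: s c => // x s IHs c sep /andP[xs us] sum0.
have xsP z : z \in s -> z \in x :: s by rewrite inE orbC => ->.
have c0 : {in s, forall y, c y = 0}.
  move=> y ys; have xy : x != y by apply: contraNneq xs => ->.
  have [h xyh] := sep x y (mem_head _ _) (xsP _ ys) xy.
  have sep' : {in s &, forall z w, z != w -> exists g, chi z g != chi w g}.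
    by move=> z w zs ws; apply: sep; apply: xsP.
  have twist g : \sum_(z <- s) c z * (chi z h - chi x h) * chi z g = 0.
    have := sum0 (mulG g h); have := congr1 ( *%R (chi x h)) (sum0 g).
    rewrite !big_cons mulrDr mulr0 mulr_sumr chiM => eq1 eq2.
    apply: (etrans _ (subr0 0)); rewrite -[X in X - _]eq2 -[X in _ - X]eq1.
    rewrite opprD addrACA [chi x h * _]mulrCA [chi x h * _]mulrC subrr add0r.
    rewrite -sumrB; apply: eq_bigr => z _; rewrite chiM; ring.
  have /eqP := IHs _ sep' us twist y ys.
  by rewrite mulf_eq0 subr_eq0 [chi y h == _]eq_sym (negPf xyh) orbF => /eqP.
move=> y; rewrite inE => /orP[/eqP ->|/c0//].
have [g xg] := chi0 x; have := sum0 g; rewrite big_cons big_seq big1 ?addr0.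
  by move/eqP; rewrite mulf_eq0 (negPf xg) orbF => /eqP.
by move=> z zs; rewrite c0 ?mul0r.
Qed.

Section Independence.
Variables (R : realType) (n : nat) (n_gt0 : (0 < n)%N).
Variables (J : juggling n) (e : R[i]).
Local Notation C := R[i].
Implicit Types (b a l : 'I_n) (m : 'X_{1..n * n}).

(** The torus elements used have the powers of 2 with exponents [g.1] and [g.2]
    as coordinates: they are all nonzero, and the character of [m] at [g] is
    [2 ^+ pairing g m]. *)
Definition pairing (g : ('I_n -> nat) * ('I_n -> nat)) m : nat :=
  (\sum_b \sum_a (g.1 b + g.2 a) * m (arc b a))%N.

Definition addg (g h : ('I_n -> nat) * ('I_n -> nat)) :=
  (fun b => g.1 b + h.1 b, fun a => g.2 a + h.2 a)%N.

Lemma pairingD g h m : pairing (addg g h) m = (pairing g m + pairing h m)%N.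
Proof.
rewrite /pairing -big_split; apply: eq_bigr => b _; rewrite -big_split /=.
by apply: eq_bigr => a _ /=; rewrite addnACA mulnDl.
Qed.

Lemma pairing_row p m :
  pairing ((fun b => b == p : nat), fun=> 0%N) m = row_deg m p.
Proof.
rewrite /pairing /row_deg (bigD1 p) //=.
rewrite [X in (_ + X)%N]big1 ?addn0 => [|b /negPf bp].
  by apply: eq_bigr => a _; rewrite eqxx mul1n.
by apply: big1 => a _; rewrite bp mul0n.
Qed.

Lemma pairing_col q m :
  pairing ((fun=> 0%N), (fun a => a == q : nat)) m = col_deg m q.
Proof.
rewrite /pairing /col_deg exchange_big (bigD1 q) //=.
rewrite [X in (_ + X)%N]big1 ?addn0 => [|a /negPf aq].
  by apply: eq_bigr => b _; rewrite eqxx mul1n.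
by apply: big1 => b _; rewrite aq mul0n.
Qed.

Lemma pairing_inj m m' :
  (forall g, pairing g m = pairing g m') -> same_degrees m m'.
Proof. by move=> gE; split=> b; rewrite -?pairing_row -?pairing_col gE. Qed.

Definition monomial_weight l m : C :=
  \prod_b \prod_a weight J e l b a ^+ m (arc b a).

Lemma meval_torus l g m :
  ('X_[m]).@[mxvec (torus_mx J e l (fun b => 2 ^+ g.1 b) (fun a => 2 ^+ g.2 a)) 0] =
  monomial_weight l m * 2 ^+ pairing g m.
Proof.
rewrite mevalX big_arc /monomial_weight /pairing expr_sum -big_split.
apply: eq_bigr => b _ /=; rewrite expr_sum -big_split; apply: eq_bigr => a _ /=.
by rewrite mxvecE torus_mxE -exprD exprMn -exprM mulrC.
Qed.

(** The characters give [f@_m * monomial_weight l m = 0] for every [l] in [L];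
    for a given [m], take a cut that none of its arcs passes over. *)
Lemma admissible_independent (f : {mpoly C[n * n]}) :
  (forall m, m \in msupp f -> admissible J m) ->
  (forall U u, inPi J e U -> hcoords U u -> f.@[mxvec u 0] = 0) -> f = 0.
Proof.
move=> adm_f van_f.
have nz2 k : (2 : C) ^+ k != 0 by rewrite expf_neq0 // pnatr_eq0.
suff coef0 m : m \in msupp f -> f@_m = 0.
  apply/mpolyP => m; rewrite mcoeff0.
  by have [/coef0//|/memN_msupp_eq0] := boolP (m \in msupp f).
move=> mf; have /admissibleP[Lm ncm] := adm_f m mf.
have [l Ll cut_l] := exists_cut (Ordinal n_gt0) ncm Lm.
have w1 : monomial_weight l m = 1.
  apply: big1 => b _; apply: big1 => a _; rewrite /weight.
  have [->|mba] := posnP (m (arc b a)); first by rewrite expr0.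
  by rewrite (Lm _ _ mba) eqxx cut_l // expr1n.
suff : f@_m * monomial_weight l m = 0 by rewrite w1 mulr1.
pose chi m' g : C := 2 ^+ pairing g m'.
apply: (@characters_free C _ addg _ chi (msupp f)
  (fun m' => f@_m' * monomial_weight l m')) => //.
- by move=> m' g h; rewrite /chi pairingD exprD.
- by move=> m'; exists (fun=> 0%N, fun=> 0%N); apply: nz2.
- move=> m1 m2 /adm_f/admissibleP[_ nc1] /adm_f/admissibleP[_ nc2] neq.
  apply: contrapT => nex; case/eqP: neq.
  apply: noncrossing_unique => //; apply: pairing_inj => g.
  have : chi m1 g = chi m2 g.
    by apply/eqP; apply: contrapT => /negP ne; apply: nex; exists g.
  by apply: ieexprIn; rewrite ?ltr0n ?pnatr_eq1.
- move=> g; have t0 b := nz2 (g.1 b); have y0 a := nz2 (g.2 a).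
  have := van_f _ _ (torus_inPi e Ll t0 y0) (torus_hcoords e Ll t0 y0).
  rewrite [f in f.@[_]]mpolyE raddf_sum /= => fE; rewrite -[RHS]fE.
  by apply: eq_bigr => m' _; rewrite mevalZ meval_torus mulrA.
Qed.

End Independence.

(** * The ideal of the variety *)

(** The evaluations [phi] of the coefficients serve to treat at once the global
    variety, where [A] is C[eps] and [phi] ranges over all the evaluations of
    [eps], and one fiber, where [A] is C and [phi] is the identity. *)
Section VanishingIdeal.
Variables (R : realType) (n : nat) (n_gt0 : (0 < n)%N) (J : juggling n).
Local Notation C := R[i].
Variables (A : comNzRingType) (e : A) (T : Type).
Variables (phi : T -> {rmorphism A -> C}) (ev : T -> C).
Hypothesis phi_e : forall z, phi z e = ev z.
Hypothesis phi_inj : forall a, (forall z, phi z a = 0) -> a = 0.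
Local Notation poly := {mpoly A[n * n]}.
Implicit Types (f g : poly).

Definition vanish f := forall z U u, inPi J (ev z) U -> hcoords U u ->
  (map_mpoly (phi z) f).@[mxvec u 0] = 0.

Definition vanish_ideal : poly -> Prop :=
  ideal_gen (fun f => (exists d, multihomog d f) /\ vanish f).

Lemma vanish_is_ideal : is_ideal vanish.
Proof.
split=> [z U u _ _|f g vf vg z U u piU uU|h f vf z U u piU uU].
- by rewrite !raddf0.
- by rewrite rmorphD mevalD [X in X + _](vf z U u) //
    [X in _ + X](vg z U u) // addr0.
- by rewrite rmorphM mevalM [X in _ * X](vf z U u) // mulr0.
Qed.

Lemma map_relation z f : relation J e f ->
  relation J (ev z) (map_mpoly (phi z) f).
Proof.
have mD b i : map_mpoly (phi z) (Delta A b i) = Delta C b i by exact: map_mpolyX.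
case=> {f} [b i i1 iJ|b s i j s_in i_in j_in si js|b s i j s_in i_in j_in si js
           |b s i j s_in i_in j_in si js|b s i j s_in i_in j_in si js];
  rewrite ?rmorphB /= ?map_mpolyZ ?rmorphM /= ?mD ?phi_e.
- exact: R1.
- exact: R2.
- exact: R3.
- exact: R4.
- exact: R5.
Qed.

Lemma vanish_relation f : relation J e f -> vanish f.
Proof.
by move=> Jf z U u piU uU; apply: relation_vanish piU uU _ (map_relation z Jf).
Qed.

Lemma relation_ideal_vanish f : relation_ideal J e f -> vanish f.
Proof. exact: ideal_gen_min vanish_is_ideal vanish_relation f. Qed.

Lemma vanish_ideal_vanish f : vanish_ideal f -> vanish f.
Proof. by apply: ideal_gen_min vanish_is_ideal _ f => g []. Qed.

Lemma vanish_ideal_relation f : relation J e f -> vanish_ideal f.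
Proof.
move=> Jf; apply: ideal_gen_mem; split; last exact: vanish_relation.
case/relation_arcs: Jf => [[b [a [_ ->]]]|[b [p [a [q [_ ->]]]]]].
  exact: multihomogX.
by apply: multihomog_binomial; case: (same_degrees_exchange b a p q).
Qed.

(** Unlike the ideal of the relations, this one contains the variables whose arc
    ends outside [L]. *)
Lemma vanish_ideal_unsupported m : supported J m \/ vanish_ideal 'X_[m].
Proof.
have [|[b [a [mba Ja]]]] := supportedVunsupported J m; first by left.
right; have [_ _ IM] : is_ideal vanish_ideal by apply: ideal_gen_ideal.
rewrite -(subU mba) addmC mpolyXD; apply/IM/ideal_gen_mem; split.
  exact: multihomogX.
move=> z U u piU uU; rewrite map_mpolyX meval_arc.
exact: unsupported_eq0 piU uU _ _ Ja.
Qed.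

Lemma vanish_admissible f :
  (forall m, m \in msupp f -> admissible J m) -> vanish f -> f = 0.
Proof.
move=> adm_f vf; apply/mpolyP => m; rewrite mcoeff0; apply: phi_inj => z.
rewrite -mcoeff_map_mpoly; suff -> : map_mpoly (phi z) f = 0 by rewrite mcoeff0.
apply: (@admissible_independent _ _ n_gt0 J (ev z)) => [m'|U u piU uU].
  rewrite mcoeff_msupp mcoeff_map_mpoly => nz; apply: adm_f.
  by rewrite mcoeff_msupp; apply: contraNneq nz => ->; rewrite raddf0.
exact: vf piU uU.
Qed.

(** An ideal of vanishing polynomials that contains the relations contains every
    vanishing polynomial whose monomials it can straighten, since the normal
    form is a vanishing combination of admissible monomials. *)
Lemma vanish_mem (I : poly -> Prop) f : is_ideal I ->
  (forall g, relation J e g -> I g) -> (forall g, I g -> vanish g) ->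
  (forall m, m \in msupp f -> supported J m \/ I 'X_[m]) ->
  vanish f -> I f.
Proof.
move=> idI relI IV sf vf; have [g [adm_g Ig]] := normal_form idI relI sf.
suff g0 : g = 0 by rewrite g0 subr0 in Ig.
apply: vanish_admissible adm_g _; rewrite -[g](subKr f).
exact: idealB vanish_is_ideal vf (IV _ Ig).
Qed.

Lemma vanish_idealP f : vanish_ideal f <-> vanish f.
Proof.
split; first exact: vanish_ideal_vanish.
apply: vanish_mem (ideal_gen_ideal _) vanish_ideal_relation vanish_ideal_vanish _.
by move=> m _; apply: vanish_ideal_unsupported.
Qed.

Lemma vanish_normal_form f :
  exists g, (forall m, m \in msupp g -> admissible J m) /\ vanish_ideal (f - g).
Proof.
apply: (@normal_form _ _ J e vanish_ideal (ideal_gen_ideal _) vanish_ideal_relation).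
by move=> m _; apply: vanish_ideal_unsupported.
Qed.

(** In these degrees a monomial is either supported on [L] or in the ideal of
    the relations, so the relations suffice to straighten [f]. *)
Lemma relation_ideal_mem f :
  (forall m, m \in msupp f -> forall b, (1 < J b)%N -> (0 < row_deg m b)%N) ->
  vanish f -> relation_ideal J e f.
Proof.
move=> df; apply: vanish_mem (ideal_gen_ideal _) _ relation_ideal_vanish _.
  exact: ideal_gen_mem.
move=> m mf; apply: (unsupported_mem (ideal_gen_ideal _) (@ideal_gen_mem _ _)).
exact: df.
Qed.

(** The first power of the product of the chart coordinates suffices: it
    raises all the row degrees. *)
Lemma saturationP f : saturation (relation_ideal J e) f <-> vanish_ideal f.
Proof.
rewrite vanish_idealP; split=> [satf z U u piU uU|vf c].
  have /fin_all_exists[c uc] b : exists k, u b k != 0.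
    have [_ /eqP nz] := uU b; apply: contrapT => nex; apply: nz; apply/rowP => k.
    by rewrite !mxE; apply/eqP; apply: contrapT => /negP ne; apply: nex; exists k.
  have [N /relation_ideal_vanish/(_ z U u piU uU)/eqP] := satf c.
  rewrite rmorphM rmorphXn rmorph_prod mevalM rmorphXn rmorph_prod /= mulf_eq0.
  rewrite expf_eq0 prodf_seq_eq0 => /orP[/andP[_ /hasP[b _]]|/eqP //].
  by rewrite map_mpolyX mevalXU mxvecE (negPf (uc b)).
exists 1%N; rewrite expr1; apply: relation_ideal_mem; last first.
  by have [_ _ VM] := vanish_is_ideal; apply: VM.
rewrite -(big_morph _ (@mpolyXD _ _) (@mpolyX0 _ _)) mulrC => m.
rewrite (perm_mem (msuppMX _ _)).
case/mapP=> m' _ -> b _; rewrite row_degD addn_gt0; apply/orP; left.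
apply/row_deg_gt0; exists (cadd b (c b)); rewrite -arcE mnm_sumE.
by rewrite (bigD1 b) //= mnm1E eqxx.
Qed.

Lemma vanish_reduced : reduced_structure J (relation_ideal J e) vanish_ideal.
Proof.
split=> [f|d f dJ df]; first exact: saturationP.
rewrite vanish_idealP; split; first exact: relation_ideal_vanish.
apply: relation_ideal_mem => m mf b /dJ; rewrite -row_degE.
by rewrite (df m mf b).
Qed.

End VanishingIdeal.

(** * The coordinate ring *)

Section CoordinateRingBasis.
Variables (R : realType) (n : nat) (n_gt0 : (0 < n)%N) (J : juggling n).
Local Notation C := R[i].
Implicit Types f g : {mpoly {poly C}[n * n]}.

Definition eval_eps (z : C) : {rmorphism {poly C} -> C} := horner_eval z.

Lemma eval_eps_X z : eval_eps z 'X = z.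
Proof. exact: hornerX. Qed.

Lemma eval_eps_inj (p : {poly C}) : (forall z, eval_eps z p = 0) -> p = 0.
Proof.
move=> p0; pose rs : seq C := [seq k%:R | k <- iota 0 (size p)].
apply: (@roots_geq_poly_eq0 _ p rs); last by rewrite size_map size_iota.
  by apply/allP => z _; apply/eqP; apply: p0.
rewrite map_inj_uniq ?iota_uniq // => k k' /eqP.
by rewrite eqr_nat => /eqP.
Qed.

Lemma global_vanishP f :
  global_ideal J f <-> vanish J eval_eps id f.
Proof. exact: (vanish_idealP n_gt0 J eval_eps_X eval_eps_inj). Qed.

Lemma Pl_projP f g : (Pl_proj J f = Pl_proj J g) <-> global_ideal J (f - g).
Proof.
split=> [fg|fg].
  apply/asboolP; change (f - g \in @global_pred R n J).
  by rewrite Quotient.idealrBE; apply/eqP.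
by apply/eqP; rewrite -Quotient.idealrBE; apply/asboolP.
Qed.

Lemma Pl_proj_sum (s : seq 'X_{1..n * n}) (c : 'X_{1..n * n} -> {poly C}) :
  Pl_proj J (\sum_(m <- s) c m *: 'X_[m]) =
  \sum_(m <- s) c m *: (Pl_proj J 'X_[m] : Pl R J).
Proof.
rewrite /Pl_proj rmorph_sum; apply: eq_bigr => m _.
by rewrite -mul_mpolyC rmorphM.
Qed.

Lemma admissible_basis : @free_basis {poly C} (Pl R J) 'X_{1..n * n}
  (admissible J) (fun m => Pl_proj J 'X_[m]).
Proof.
split=> [x|s c us adm_s sum0].
  have [f ->] : exists f, x = Pl_proj J f by exists (repr x); rewrite /Pl_proj reprK.
  have [g [adm_g fg]] := vanish_normal_form J eval_eps_X f.
  exists (msupp g), (fun m => g@_m); split=> //; rewrite -Pl_proj_sum -mpolyE.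
  exact/Pl_projP.
pose f := \sum_(m <- s) c m *: 'X_[m] : {mpoly {poly C}[n * n]}.
have fE m : f@_m = if m \in s then c m else 0.
  rewrite /f raddf_sum /=; case: ifP => ms; last first.
    rewrite big_seq big1 // => m' m's; rewrite mcoeffZ mcoeffX.
    by case: eqP ms => [<-|_]; rewrite ?m's // mulr0.
  rewrite (bigD1_seq m) //= mcoeffZ mcoeffX eqxx mulr1 big1 ?addr0 // => m' mm'.
  by rewrite mcoeffZ mcoeffX (negPf mm') mulr0.
suff f0 : f = 0 by move=> m ms; have := fE m; rewrite ms f0 mcoeff0.
apply: (@vanish_admissible _ _ n_gt0 J _ _ eval_eps id eval_eps_inj) => [m|].
  by rewrite mcoeff_msupp fE; case: ifP => [/adm_s adm_m _|_ /eqP].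
apply/global_vanishP; rewrite -[f]subr0; apply/Pl_projP.
by rewrite Pl_proj_sum sum0 /Pl_proj rmorph0.
Qed.

End CoordinateRingBasis.

Section Fiber.
Variables (R : realType) (n : nat) (n_gt0 : (0 < n)%N).
Variables (J : juggling n) (e : R[i]).

Definition no_eval (_ : unit) : {rmorphism R[i] -> R[i]} := idfun.

Lemma fiber_vanish_ideal f :
  vanish_ideal J no_eval (fun=> e) f <-> fiber_ideal J e f.
Proof.
have id_map (g : {mpoly R[i][n * n]}) : map_mpoly (no_eval tt) g = g.
  by apply/mpolyP => m; rewrite mcoeff_map_mpoly.
split; apply: ideal_gen_min (ideal_gen_ideal _) _ f => g [hg vg];
  apply: ideal_gen_mem; split=> //.
  by move=> U u piU uU; have := vg tt U u piU uU; rewrite id_map.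
by case=> U u piU uU; rewrite id_map; apply: vg piU uU.
Qed.

Lemma fiber_reduced :
  reduced_structure J (relation_ideal J e) (@fiber_ideal R n J e).
Proof.
have [sat deg] := @vanish_reduced R n n_gt0 J _ e _ no_eval (fun=> e)
  (fun=> erefl) (fun a a0 => a0 tt).
split=> [f|d f dJ df].
  exact: iff_trans (sat f) (fiber_vanish_ideal f).
exact: iff_trans (deg d f dJ df) (fiber_vanish_ideal f).
Qed.

End Fiber.

Theorem theoremA9 (R : realType) (n : nat) (hn : (2 <= n)%N) (J : juggling n) :
  @free_basis {poly R[i]} (Pl R J) 'X_{1..n * n}
    (admissible J) (fun m => Pl_proj J 'X_[m])
  /\ reduced_structure J (@relation_ideal n {poly R[i]} J 'X) (@global_ideal R n J)
  /\ (forall e : R[i],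
        reduced_structure J (@relation_ideal n R[i] J e) (@fiber_ideal R n J e)).
Proof.
have n_gt0 : (0 < n)%N := ltnW hn.
split; first exact: admissible_basis.
split=> [|e]; last exact: fiber_reduced.
exact: (vanish_reduced n_gt0 J (@eval_eps_X R) (@eval_eps_inj R)).
Qed.
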